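(* Let $q$ be an odd prime power, let $g$ be a positive divisor of $q-1$, let $m>1$ be an integer, and put $$d=2q^m-\frac{(g+1)(q^m-q^{m-1})}{g}.$$ Then $$A_{g+1}\left(\frac{q^{m+1}-1}{q-1}-1,\;d,\;q^m-1\right)=q^m$$ and $$A_{g+1}\left(\frac{q^{m+1}-1}{q-1},\;d,\;q^m\right)=g\,\frac{q^{m+1}-1}{q-1}.$$ Moreover, let $\omega$ be a primitive element of $\mathrm{GF}(q)$, let $\omega'=\omega^{(q-1)/g}$, and let $C=\langle\omega'\rangle$ be the subgroup of order $g$ of $\mathrm{GF}(q)^*$. Then there is an optimal code attaining the second equality, over the alphabet $C\cup\{0\}$, that is generated entirely by the $\omega'$-shifts of a single codeword; that is, there is a constant weight code of length $\frac{q^{m+1}-1}{q-1}$, weight $q^m$, minimum distance $d$ and size $g\frac{q^{m+1}-1}{q-1}$ over $C\cup\{0\}$ which is exactly the set of all vectors obtained from one codeword by repeatedly applying the $\omega'$-shift.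
   Context: A code of length $n$ over a finite alphabet $\mathcal{A}$ containing the symbol $0$ is a nonempty subset of $\mathcal{A}^n$. The weight of a word is the number of its nonzero components. The Hamming distance $\mathrm{dist}(x,y)$ is the number of coordinates in which $x$ and $y$ differ, and the minimum distance of a code is the smallest distance between two distinct codewords. A code is constant weight, of weight $w$, if all its codewords have weight $w$. $A_r(n,d,w)$ denotes the maximum size of a constant weight code of length $n$, weight $w$ and minimum distance at least $d$ over an alphabet of size $r$ containing $0$. A code is optimal if its size equals this maximum. For an element $\eta\in\mathrm{GF}(q)^*$, the $\eta$-shift of a vector $(c_0,c_1,\dots,c_{n-1})$ with entries in $\mathrm{GF}(q)$ is $(\eta c_{n-1},c_0,c_1,\dots,c_{n-2})$, where $\eta\cdot 0=0$. *)

(* Defs.v *)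
From mathcomp Require Import all_boot all_order all_algebra all_fingroup all_solvable.
Set Implicit Arguments.
Unset Strict Implicit.
Unset Printing Implicit Defensive.
Import GRing.Theory.

Section Codes.
Variables (T : finType) (n : nat).
Implicit Types (x y : {ffun 'I_n -> T}) (C : {set {ffun 'I_n -> T}}).

Definition weight (z : T) x : nat := #|[set i | x i != z]|.

Definition hdist x y : nat := #|[set i | x i != y i]|.

(* Vacuously true when [C] has at most one word. *)
Definition min_dist_ge (d : nat) C : bool :=
  [forall x in C, forall y in C, (x != y) ==> (d <= hdist x y)].

Definition min_dist_eq (d : nat) C : bool :=
  min_dist_ge d C && [exists x in C, exists y in C, (x != y) && (hdist x y == d)].

(* The alphabet is a subset [A] of an ambient finite type [T]; the element [z] *)
(* of [A] plays the role of the symbol 0.                                      *)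
Definition code_over (z : T) (A : {set T}) C : bool :=
  [&& z \in A, C != set0 & [forall x in C, forall i, x i \in A]].

Definition cw_code (z : T) (A : {set T}) (d w : nat) C : bool :=
  [&& code_over z A C, [forall x in C, weight z x == w] & min_dist_ge d C].

End Codes.

(* [A_max r n d w] is A_r(n, d, w), computed over the alphabet {0, ..., r - 1}; *)
(* meaningful for [0 < r] only.  By [leq_A_max] it also bounds the codes over   *)
(* any other alphabet of size r.  The value is 0 if there is no such code.      *)
Definition A_max (r n d w : nat) : nat :=
  \max_(C : {set {ffun 'I_n -> 'I_r.-1.+1}} | cw_code ord0 setT d w C) #|C|.

Definition optimal_cw_code (T : finType) (n : nat) (z : T) (A : {set T})
    (d w : nat) (C : {set {ffun 'I_n -> T}}) : bool :=
  cw_code z A d w C && (#|C| == A_max #|A| n d w).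

(* [ord_pred] is the cyclic predecessor on ['I_n]. *)
Definition eta_shift (R : nzRingType) (n : nat) (eta : R) (c : {ffun 'I_n -> R}) :
    {ffun 'I_n -> R} :=
  [ffun i : 'I_n =>
     if val i == 0 then (eta * c (ord_pred i))%R else c (ord_pred i)].

Lemma leq_A_max (T : finType) (n : nat) (z : T) (A : {set T}) (d w : nat)
    (C : {set {ffun 'I_n -> T}}) :
  cw_code z A d w C -> #|C| <= A_max #|A| n d w.
Proof.
case/and3P=> /and3P[zA C0 /forall_inP CA] /forall_inP Cw /forall_inP Cd.
pose s := z :: enum (A :\ z).
have sz : size s = #|A|.-1.+1 by rewrite /= -cardE (cardsD1 z A) zA.
have sA x : (x \in s) = (x \in A).
  by rewrite inE mem_enum !inE; case: eqP => [->|].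
pose f x : 'I_#|A|.-1.+1 := inord (index x s).
have finj : {in A &, injective f}.
  move=> x y xA yA /(congr1 val).
  rewrite [val (f x)]inordK -?sz ?index_mem ?sA //.
  rewrite [val (f y)]inordK -?sz ?index_mem ?sA // => e.
  by rewrite -(nth_index z (_ : x \in s)) ?sA // e nth_index ?sA.
have f0 x : x \in A -> (f x == ord0) = (x == z).
  move=> xA; have fz : f z = ord0.
    by apply: val_inj; rewrite /f /= eqxx inordK.
  by rewrite -fz (inj_in_eq finj).
pose F (c : {ffun 'I_n -> T}) := [ffun i => f (c i)].
have Ai x i : x \in C -> x i \in A by move=> /CA /forallP /(_ i).
have Finj : {in C &, injective F}.
  move=> x y xC yC /ffunP e; apply/ffunP=> i; apply: finj; rewrite ?Ai //.
  by have := e i; rewrite !ffunE.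
rewrite -(card_in_imset Finj).
rewrite /A_max; apply: (@leq_bigmax_cond _ _ (fun C : {set {ffun 'I_n -> _}} => #|C|)).
apply/and3P; split.
- apply/and3P; split; rewrite ?inE //.
  + by case/set0Pn: C0 => c cC; apply/set0Pn; exists (F c); apply: imset_f.
  + by apply/forall_inP=> x _; apply/forallP=> i; rewrite inE.
- apply/forall_inP=> _ /imsetP[x xC ->]; rewrite -(eqP (Cw x xC)); apply/eqP.
  by apply: eq_card => i; rewrite !inE ffunE f0 ?Ai.
- apply/forall_inP=> _ /imsetP[x xC ->]; apply/forall_inP=> _ /imsetP[y yC ->].
  rewrite (inj_in_eq Finj) //; apply/implyP=> xy.
  have /forall_inP/(_ y yC)/implyP/(_ xy) /leq_trans := Cd x xC; apply.
  by rewrite leq_eqVlt (_ : hdist x y = hdist (F x) (F y)) ?eqxx //;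
    apply: eq_card => i; rewrite !inE !ffunE (inj_in_eq finj) ?Ai.
Qed.

(* Main.v *)
(* The upper bounds are the Plotkin-type count of [plotkin_bound] for length    *)
(* n - 1, and the Johnson shortening inequality, which carries it to length n.  *)
(* For the construction, let K = GF(q^(m+1)), Tr : K -> GF(q) the trace, b a    *)
(* primitive element of K, and psi a multiplicative map from GF(q)^* onto the   *)
(* group of order g, extended by psi 0 = 0.  The words (psi (Tr (a b^i)))_(i<n) *)
(* for a != 0 are the simplex code, in its constacyclic form, reduced through   *)
(* psi.  When a / a' is not in GF(q), the pair (Tr (a x), Tr (a' x)) takes each *)
(* value in GF(q)^2 equally often as x ranges over K, so that the two words are *)
(* at distance exactly d.                                                       *)
(* Equality in the Johnson inequality for this code forces some shortened code  *)
(* to have q^m words, which settles the first equality as well.                 *)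

Require Import Defs.
From mathcomp Require Import all_boot all_order all_algebra all_fingroup all_solvable all_field.
From mathcomp Require Import ring lra zify.
Set Implicit Arguments.
Unset Strict Implicit.
Unset Printing Implicit Defensive.
Import Order.TTheory GRing.Theory Num.Theory.

(** With t the mean number of nonzero entries per coordinate, [plotkin_bound] at length n - 1
    becomes (M - 1) q^m <= M (q^m - 1): d equals q^m E for a positive factor E that also appears on
    the right. Hence M <= q^m ([A_max_shortened_le]), and [A_max_le_of_shortened] bounds the size at
    length n by g n.

    The code reaches g n. Two words whose parameters are independent over GF(q) agree exactly where
    both traces vanish or where their ratio lies in the kernel of [psi] ([card_agree]). Two words
    with proportional parameters are equal or lie at distance q^m >= d ([hdist_wordZ],
    [d_le_weight]). Counts over K pass to counts over coordinates after division by q - 1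
    ([card_homogeneous]). The shift divides the parameter by the generator b of K^*
    ([eta_shift_word]), so a single orbit is the whole code ([code_orbit]). *)

(** * Double counting and the Johnson inequality *)

Lemma weightE (T : finType) (n : nat) (z : T) (x : {ffun 'I_n -> T}) :
  weight z x = \sum_i (x i != z).
Proof. by rewrite /weight -sum1dep_card big_mkcond. Qed.

Lemma hdistE (T : finType) (n : nat) (x y : {ffun 'I_n -> T}) :
  hdist x y = \sum_i (x i != y i).
Proof. by rewrite /hdist -sum1dep_card big_mkcond. Qed.

Lemma card_symbol_split (T : finType) (n : nat) (z : T) (A : {set T})
    (C : {set {ffun 'I_n -> T}}) (i : 'I_n) :
  (forall x, x \in C -> x i \in A) ->
  \sum_(x in C) (x i != z) = \sum_(s in A :\ z) #|[set x in C | x i == s]|.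
Proof.
move=> CA; rewrite -big_mkcondr /=
    (partition_big (fun x : {ffun 'I_n -> T} => x i) (mem (A :\ z))) /=.
  apply: eq_bigr => s; rewrite !inE => /andP[sz sA].
  rewrite -sum1dep_card; apply: eq_bigl => x.
  by case: (x i =P s) => [->|_]; rewrite ?sz ?andbT ?andbF.
by move=> x /andP[xC xz]; rewrite !inE xz CA.
Qed.

(** Nonzero entries are counted by coordinate. The words with a fixed nonzero symbol at coordinate i
    lose one unit of weight and no distance when that coordinate is deleted. *)
Lemma johnson_bound (T : finType) (n d w : nat) (z : T) (A : {set T})
    (C : {set {ffun 'I_n.+1 -> T}}) :
  cw_code z A d w C ->
  #|C| * w <= n.+1 * #|A :\ z| * A_max #|A| n d w.-1.
Proof.
case/and3P=> /and3P[zA C0 /forall_inP CA] /forall_inP Cw /forall_inP Cd.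
have -> : #|C| * w = \sum_(x in C) \sum_i (x i != z).
  by rewrite -sum_nat_const; apply: eq_bigr => x /Cw /eqP <-; rewrite weightE.
rewrite exchange_big /= -mulnA -[n.+1 in leqRHS](card_ord n.+1).
rewrite -[leqRHS]sum_nat_const.
apply: leq_sum => i _; rewrite (@card_symbol_split _ _ z A); last first.
  by move=> x /CA /forallP.
rewrite -sum_nat_const; apply: leq_sum => s /setD1P[sz sA].
set Ci := [set x in C | _].
have [->|Ci0] := eqVneq Ci set0; first by rewrite cards0.
pose del (x : {ffun 'I_n.+1 -> T}) := [ffun j => x (lift i j)].
have cnt (P : pred 'I_n.+1) : #|[set j | P j]| = P i + #|[set j | P (lift i j)]|.
  by rewrite -!sum1dep_card big_mkcond [in RHS]big_mkcond /= (bigD1_ord i).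
have hdel x y : x \in Ci -> y \in Ci -> hdist (del x) (del y) = hdist x y.
  rewrite !inE => /andP[_ /eqP xi] /andP[_ /eqP yi].
  rewrite /hdist cnt xi yi eqxx add0n.
  by apply: eq_card => j; rewrite !inE !ffunE.
have delK : {in Ci &, injective del}.
  move=> x y; rewrite !inE => /andP[_ /eqP xi] /andP[_ /eqP yi] /ffunP e.
  apply/ffunP=> j; case: (unliftP i j) => [k ->|->]; last by rewrite xi yi.
  by have := e k; rewrite !ffunE.
have CiC x : x \in Ci -> x \in C by rewrite inE => /andP[].
rewrite -(card_in_imset delK); apply: (@leq_A_max _ _ z).
apply/and3P; split.
- apply/and3P; split=> //.
    by case/set0Pn: Ci0 => x xC; apply/set0Pn; exists (del x); apply: imset_f.
  apply/forall_inP=> _ /imsetP[x /CiC/CA/forallP xA ->].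
  by apply/forallP=> j; rewrite ffunE.
- apply/forall_inP=> _ /imsetP[x xCi ->].
  have /Cw/eqP <- := CiC x xCi; move: xCi; rewrite inE => /andP[_ /eqP xi].
  rewrite /weight [in eqbRHS]cnt xi sz; apply/eqP/eq_card => j.
  by rewrite !inE ffunE.
- apply/forall_inP=> _ /imsetP[x xC ->]; apply/forall_inP=> _ /imsetP[y yC ->].
  rewrite (inj_in_eq delK) // hdel //.
  by have /forall_inP/(_ y (CiC y yC)) := Cd x (CiC x xC).
Qed.

(** * The Plotkin-type bound *)

Local Open Scope ring_scope.

Lemma sumr_sqr_ge (R : realFieldType) (I : finType) (A : {set I}) (f : I -> R) (u : R) :
  \sum_(i in A) f i ^+ 2 >= (\sum_(i in A) f i) * u *+ 2 - #|A|%:R * u ^+ 2.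
Proof.
rewrite -subr_ge0 opprB mulr_suml -sumrMnl.
rewrite -mulr_natl mulr1 -sumr_const big_distrl /= -!sumrN -!big_split /=.
by apply: sumr_ge0 => i _; rewrite mul1r; have := sqr_ge0 (f i - u); lra.
Qed.

(* The parameter t linearises squares through k ^ 2 >= 2 k t - t ^ 2, which     *)
(* replaces Cauchy-Schwarz; the optimal t is the mean number of nonzero entries *)
(* in a coordinate.                                                             *)
Lemma plotkin_bound (T : finType) (n d w : nat) (z : T) (A : {set T})
    (C : {set {ffun 'I_n -> T}}) (t : rat) (M := #|C|%:R : rat)
    (g := #|A :\ z|%:R : rat) :
  cw_code z A d w C -> 0 < g ->
  M * (M - 1) * d%:R <=
    2 * M ^+ 2 * w%:R - (1 + g^-1) * (2 * M * w%:R * t - n%:R * t ^+ 2).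
Proof.
case/and3P=> /and3P[zA C0 /forall_inP CA] /forall_inP Cw /forall_inP Cd g0.
pose k i s := #|[set x in C | x i == s]|.
pose K i := (\sum_(x in C) (x i != z))%N.
have KE i : K i = (\sum_(s in A :\ z) k i s)%N.
  by apply: card_symbol_split => x /CA /forallP.
have sumK : (\sum_i K i = #|C| * w)%N.
  rewrite exchange_big -sum_nat_const; apply: eq_bigr => x /Cw /eqP <-.
  by rewrite weightE.
have kz i : (k i z + K i = #|C|)%N.
  rewrite /K -big_mkcondr sum1dep_card -(cardsID [set x : {ffun _} | x i == z] C).
  by congr (_ + _)%N; apply: eq_card => x; rewrite !inE // andbC.
have pairs i : (\sum_(x in C) \sum_(y in C) (x i != y i) + \sum_(s in A) k i s ^ 2
    = #|C| ^ 2)%N.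
  have -> : (\sum_(s in A) k i s ^ 2 = \sum_(x in C) \sum_(y in C) (x i == y i))%N.
    rewrite (partition_big (fun x : {ffun 'I_n -> T} => x i) (mem A)) /=; last first.
      by move=> x /CA /forallP.
    apply: eq_bigr => s _; rewrite expnS expn1.
    rewrite {1}/k -sum1dep_card big_distrl /=; apply: eq_bigr => x /andP[_ /eqP xs].
    rewrite mul1n -big_mkcondr sum1dep_card; apply: eq_card => y.
    by rewrite !inE xs eq_sym.
  rewrite -big_split /= expnS expn1 -[in RHS]sum_nat_const; apply: eq_bigr => x _.
  rewrite -big_split /= -sum1_card; apply: eq_bigr => y _.
  by case: eqP.
have lower : (#|C| * (#|C| - 1) * d <= \sum_(x in C) \sum_(y in C) hdist x y)%N.
  rewrite -mulnA -sum_nat_const; apply: leq_sum => x xC.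
  rewrite (bigD1 x) //= (leq_trans _ (leq_addl _ _)) // (cardsD1 x C) xC add1n subn1 /=.
  rewrite -sum_nat_const (eq_bigl (fun y => (y \in C) && (y != x))); last first.
    by move=> y; rewrite !inE andbC.
  apply: leq_sum => y /andP[yC yx].
  by have /forall_inP/(_ y yC)/implyP := Cd x xC; apply; rewrite eq_sym.
have swap : (\sum_(x in C) \sum_(y in C) hdist x y =
    \sum_i \sum_(x in C) \sum_(y in C) (x i != y i))%N.
  rewrite [RHS]exchange_big /=; apply: eq_bigr => x _.
  by rewrite [RHS]exchange_big /=; apply: eq_bigr => y _; rewrite hdistE.
have upper i : (\sum_(x in C) \sum_(y in C) (x i != y i))%N%:R <=
    2 * M * (K i)%:R - (1 + g^-1) * (2 * (K i)%:R * t - t ^+ 2).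
  move: (\sum_(x in C) _)%N (pairs i) => P.
  rewrite (big_setD1 z) //= => /(congr1 (fun a : nat => a%:R : rat)).
  rewrite !natrD !natrX natr_sum.
  under eq_bigr do rewrite natrX.
  (* The value t / g spreads t evenly over the g nonzero symbols; the square of [K i], which comes
     from the frequency M - [K i] of the zero symbol, is linearised at t itself. *)
  have := @sumr_sqr_ge rat _ (A :\ z) (fun s => (k i s)%:R) (t / g).
  rewrite -natr_sum -KE -/g.
  have -> : #|C|%:R = (k i z)%:R + (K i)%:R :> rat by rewrite -natrD kz.
  have -> : M = (k i z)%:R + (K i)%:R by rewrite -natrD kz.
  have -> : g * (t / g) ^+ 2 = g^-1 * t ^+ 2 by field; rewrite gt_eqF.
  have := sqr_ge0 ((K i)%:R - t).
  move: (g^-1) => h; nra.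
have {lower} : (#|C| * (#|C| - 1) * d)%N%:R <= \sum_i
    (2 * M * (K i)%:R - (1 + g^-1) * (2 * (K i)%:R * t - t ^+ 2)).
  apply: (@le_trans _ _ (\sum_i (\sum_(x in C) \sum_(y in C) (x i != y i))%N%:R)).
    by rewrite -natr_sum ler_nat -swap.
  by apply: ler_sum => i _; apply: upper.
have C1 : (0 < #|C|)%N by rewrite card_gt0.
rewrite !natrM natrB // -/M => /le_trans; apply.
rewrite big_split /= sumrN -!mulr_sumr big_split /= sumrN -mulr_suml -mulr_sumr.
rewrite -natr_sum sumK natrM -/M sumr_const card_ord -[t ^+ 2 *+ n]mulr_natl.
by rewrite le_eqVlt; apply/orP; left; apply/eqP; ring.
Qed.

(** * Upper bounds for the parameters of the theorem *)

Lemma card_nonzero_symbol (r : nat) :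
  #|[set: 'I_(r + 1).-1.+1] :\ ord0| = r.
Proof.
rewrite addn1; apply/eqP; rewrite -eqSS -[X in _ == X](card_ord r.+1) -cardsT.
by rewrite (cardsD1 ord0 setT) inE.
Qed.

Lemma A_max_shortened_le (q g m L d : nat) :
  (1 < q)%N -> (0 < g)%N -> (L * (q - 1) = q * (q ^ m - 1))%N ->
  (q * g * d + (g + 1) * (q - 1) * q ^ m = 2 * g * q * q ^ m)%N ->
  (A_max (g + 1) L d (q ^ m - 1) <= q ^ m)%N.
Proof.
move=> q1 g0 hL hd; apply/bigmax_leqP => C cC.
have Q0 : (0 < q ^ m)%N by rewrite expn_gt0 ltnW.
have gT := card_nonzero_symbol g.
have C1 : (0 < #|C|)%N by case/and3P: cC => /and3P[_]; rewrite card_gt0.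
(* The mean number of nonzero entries per coordinate is M (q^m - 1) / L, which [hL] turns into M (q
   - 1) / q. *)
have := @plotkin_bound _ _ _ _ _ _ _ (#|C|%:R * (q%:R - 1) / q%:R) cC.
rewrite gT ltr0n g0 => /(_ isT).
have := congr1 (fun a : nat => a%:R : rat) hd.
have := congr1 (fun a : nat => a%:R : rat) hL.
rewrite -(ler_nat rat) !(natrD, natrM) !natrB ?(ltnW q1) //.
have : 1 < q%:R :> rat by rewrite ltr1n.
have : 0 < g%:R :> rat by rewrite ltr0n.
have : 0 < (q ^ m)%:R :> rat by rewrite ltr0n.
have : 1 <= #|C|%:R :> rat by rewrite ler1n.
have : 1 <= g%:R :> rat by rewrite ler1n.
move: (#|C|%:R) (q%:R) (g%:R) (d%:R) (L%:R) ((q ^ m)%:R).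
move=> M x h D l Q h1 M1 Qp hp x1 eL eD.
have x0 : x != 0 by rewrite gt_eqF // (lt_trans ltr01).
have x10 : x - 1 != 0 by rewrite subr_eq0 gt_eqF.
have h0 : h != 0 by rewrite gt_eqF.
have {}eL : l = x * (Q - 1) / (x - 1) by rewrite -eL mulfK.
pose E := 2 - (1 + h^-1) * ((x - 1) / x).
have {}eD : D = Q * E.
  apply: (mulfI (x := x * h)); first by rewrite mulf_neq0.
  rewrite -[LHS](addrK ((h + 1) * (x - 1) * Q)) eD /E.
  by field; rewrite h0 x0.
have E0 : 0 < E.
  have : h^-1 <= 1 by rewrite invf_le1.
  have : 0 < x^-1 < 1 by rewrite invr_gt0 invf_lt1 ?(lt_trans ltr01) // x1 andbT.
  have -> : E = 2 - (1 + h^-1) * (1 - x^-1) by rewrite /E; field; rewrite h0 x0.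
  case/andP; nra.
have -> : 2 * M ^+ 2 * (Q - 1) - (1 + h^-1) *
    (2 * M * (Q - 1) * (M * (x - 1) / x) - l * (M * (x - 1) / x) ^+ 2) =
    M ^+ 2 * (Q - 1) * E.
  by rewrite eL /E; field; rewrite h0 x0 x10.
rewrite {}eD mulrA ler_pM2r // expr2 -!mulrA ler_pM2l ?(lt_le_trans ltr01) //.
lra.
Qed.

Local Close Scope ring_scope.

Lemma A_max_le_of_shortened (r n d w : nat) :
  A_max (r + 1) n.+1 d w * w <= n.+1 * r * A_max (r + 1) n d w.-1.
Proof.
rewrite {1}/A_max.
elim/big_ind: _ => // [x y hx hy|C cC]; first by rewrite maxnMl geq_max hx.
have gT := card_nonzero_symbol r.
have cT : #|[set: 'I_(r + 1).-1.+1]| = r + 1 by rewrite cardsT card_ord addn1.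
by have := johnson_bound cC; rewrite gT cT.
Qed.

Local Open Scope ring_scope.

Lemma divf_eq (R : fieldType) (x y t : R) : t != 0 -> (x / t == y) = (x == y * t).
Proof. by move=> t0; rewrite -(inj_eq (mulIf t0)) divfK. Qed.

Lemma prim_root_neq0 (R : fieldType) (n : nat) (z : R) : n.-primitive_root z -> z != 0.
Proof.
move=> zn; apply: contra_eq_neq (prim_expr_order zn) => ->.
by rewrite expr0n gtn_eqF ?(prim_order_gt0 zn) // eq_sym oner_eq0.
Qed.

(** * The trace from GF(q^(m+1)) to GF(q) and its kernels *)

Section Trace.

Variables (K : finFieldType) (q m : nat).
Hypotheses (q_gt1 : (1 < q)%N) (q_char : [pchar K].-nat q) (cardK : #|K| = (q ^ m.+1)%N).

Definition tr (x : K) : K := \sum_(i < m.+1) x ^+ (q ^ i).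

(** The copy of GF(q) inside K. *)
Definition fixed : {set K} := [set x | x ^+ q == x].

Lemma trD x y : tr (x + y) = tr x + tr y.
Proof.
rewrite -big_split; apply: eq_bigr => i _ /=.
by rewrite exprDn_pchar // pnatX q_char.
Qed.

Lemma tr0 : tr 0 = 0.
Proof. by apply: (addrI (tr 0)); rewrite -trD !addr0. Qed.

Lemma trB x y : tr (x - y) = tr x - tr y.
Proof. by apply: (addIr (tr y)); rewrite -trD !subrK. Qed.

Lemma trZ c x : c \in fixed -> tr (c * x) = c * tr x.
Proof.
rewrite inE => /eqP cq; rewrite mulr_sumr; apply: eq_bigr => i _.
rewrite exprMn; congr (_ * _); elim: (nat_of_ord i) => [|k IH]; first by rewrite expn0.
by rewrite expnS exprM cq.
Qed.

Lemma tr_fixed x : tr x \in fixed.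
Proof.
have frobD : {morph (fun y : K => y ^+ q) : y z / y + z}.
  by move=> y z; rewrite exprDn_pchar.
have frob0 : 0 ^+ q = 0 :> K by rewrite expr0n; case: q q_gt1.
rewrite inE /tr (big_morph _ frobD frob0).
(* The Frobenius map sends each summand to the next, and the last one returns to x because
   x^(q^(m+1)) = x. *)
rewrite big_ord_recr /= -exprM -expnSr -cardK expf_card.
rewrite [X in _ == X]big_ord_recl expn0 expr1 addrC; apply/eqP; congr (_ + _).
by apply: eq_bigr => i _; rewrite -exprM -expnSr.
Qed.

Lemma fixed1 : 1 \in fixed.
Proof. by rewrite inE expr1n. Qed.

Lemma fixedM x y : x \in fixed -> y \in fixed -> x * y \in fixed.
Proof. by rewrite !inE exprMn => /eqP-> /eqP->. Qed.

Lemma fixedV x : x \in fixed -> x^-1 \in fixed.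
Proof. by rewrite !inE exprVn => /eqP->. Qed.

Lemma card_roots_lt (p : {poly K}) : p != 0 -> (#|[set x | root p x]| < size p)%N.
Proof.
move=> p0; rewrite cardE; apply: max_poly_roots => //; last exact: enum_uniq.
by apply/allP => x; rewrite mem_enum inE.
Qed.

Lemma card_fixed_le : (#|fixed| <= q)%N.
Proof.
have sz : size ('X^q - 'X : {poly K}) = q.+1.
  by rewrite size_polyDl size_polyXn // size_polyN size_polyX.
have := @card_roots_lt ('X^q - 'X); rewrite -size_poly_eq0 sz ltnS => /(_ isT).
suff -> : fixed = [set x | root ('X^q - 'X) x] by [].
by apply/setP => x; rewrite !inE rootE !hornerE subr_eq0.
Qed.

Lemma card_ker_tr_le : (#|[set x | tr x == 0%R]| <= q ^ m)%N.
Proof.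
pose p : {poly K} := \sum_(i < m.+1) 'X^(q ^ i).
have sz : size p = (q ^ m).+1.
  rewrite /p big_ord_recr /= addrC size_polyDl size_polyXn // ltnS.
  apply: (leq_trans (size_sum _ _ _)); apply/bigmax_leqP => i _.
  by rewrite size_polyXn ltn_exp2l.
have := @card_roots_lt p; rewrite -size_poly_eq0 sz ltnS => /(_ isT).
suff -> : [set x | tr x == 0] = [set x | root p x] by [].
apply/setP => x; rewrite !inE rootE /p horner_sum; congr (_ == _).
by apply: eq_bigr => i _; rewrite hornerXn.
Qed.

Lemma card_le_fixed_ker : (#|K| <= #|fixed| * #|[set x | tr x == 0%R]|)%N.
Proof.
rewrite -[leqLHS]sum1_card (partition_big tr (mem fixed)) /=; last first.
  by move=> x _; apply: tr_fixed.
rewrite -[leqRHS]sum_nat_const; apply: leq_sum => c _.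
rewrite sum1dep_card; have [->|[x0]] := set_0Vmem [set x | tr x == c].
  by rewrite cards0.
rewrite inE => /eqP x0c; rewrite -(card_imset _ (addIr (- x0))).
apply/subset_leq_card/subsetP => _ /imsetP[x xc ->].
by move: xc; rewrite !inE trB x0c => /eqP->; rewrite subrr.
Qed.

(** Degrees allow at most q fixed points and at most q^m kernel elements. Nonempty fibres of [tr]
    are translates of the kernel, so the product of the two sizes is at least q^(m+1), and both
    bounds are attained. *)
Lemma card_fixed : #|fixed| = q.
Proof.
have qm0 : (0 < q ^ m)%N by rewrite expn_gt0 ltnW.
apply/eqP; rewrite eqn_leq card_fixed_le /= -(leq_pmul2r qm0) -expnS -cardK.
by apply: leq_trans card_le_fixed_ker _; rewrite leq_mul2l card_ker_tr_le orbT.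
Qed.

Lemma card_ker_tr : #|[set x | tr x == 0%R]| = (q ^ m)%N.
Proof.
have q0 := ltnW q_gt1.
apply/eqP; rewrite eqn_leq card_ker_tr_le -(leq_pmul2l q0).
by rewrite -expnS -cardK -{1}card_fixed card_le_fixed_ker.
Qed.

Lemma card_ker_trM a : a != 0 -> #|[set x | tr (a * x) == 0%R]| = (q ^ m)%N.
Proof.
move=> a0; rewrite -card_ker_tr -(card_imset _ (mulfI a0)).
apply: eq_card => x; rewrite inE; apply/imsetP/idP => [[y]|xk].
  by rewrite inE => ? ->.
by exists (x / a); rewrite ?inE mulrC divfK.
Qed.

Definition both_zero a b : {set K} := [set x | (tr (a * x) == 0) && (tr (b * x) == 0)].

Definition ratio_set a b c : {set K} :=
  [set x | (tr (b * x) != 0) && (tr (a * x) == c * tr (b * x))].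

(** By linearity tr (a x) = c tr (b x) means tr ((a - c b) x) = 0, and a - c b is nonzero because a
    / b lies outside GF(q). *)
Lemma card_ker_trM_ratio a b c : a != 0 -> a / b \notin fixed -> c \in fixed ->
  (#|ratio_set a b c| + #|both_zero a b| = q ^ m)%N.
Proof.
move=> a0 abF cF; have acb : a - c * b != 0.
  apply: contraNneq abF => /eqP; rewrite subr_eq0 => /eqP acb.
  have b0 : b != 0 by apply: contraNneq a0 => b0; rewrite acb b0 mulr0.
  by rewrite acb mulfK.
rewrite -(card_ker_trM acb) addnC -[RHS](cardsID [set x | tr (b * x) == 0]).
congr (_ + _)%N; apply: eq_card => x; rewrite !inE mulrBl trB -mulrA (trZ _ cF) subr_eq0 //.
by case: (tr (b * x) =P 0) => [->|]; rewrite ?andbF // mulr0 andbT.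
Qed.

(* The nonzero values of the pair of traces are classified by their ratio, each *)
(* ratio in GF(q) being taken equally often by [card_ker_trM_ratio]; summing    *)
(* over the q ratios determines the size of the common kernel.                  *)
Lemma card_ker_tr2 a b : a != 0 -> b != 0 -> a / b \notin fixed ->
  (q * #|both_zero a b| = q ^ m)%N.
Proof.
move=> a0 b0 abF; set Z := #|_|.
have part : (#|K| = q ^ m + \sum_(c in fixed) #|ratio_set a b c|)%N.
  rewrite -(card_ker_trM b0) -cardsT -(cardsID [set x | tr (b * x) == 0]).
  congr (_ + _)%N; first by apply: eq_card => x; rewrite !inE.
  rewrite -sum1_card (partition_big (fun x => tr (a * x) / tr (b * x)) (mem fixed)) /=.
    apply: eq_bigr => c cF; rewrite sum1dep_card; apply: eq_card => x.
    rewrite !inE andbT; case: eqP => //= /eqP t0; by rewrite divf_eq.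
  by move=> x _; rewrite fixedM ?fixedV ?tr_fixed.
have sumF : ((\sum_(c in fixed) #|ratio_set a b c|) + q * Z = q ^ m.+1)%N.
  have -> : (q * Z = \sum_(c in fixed) Z)%N by rewrite sum_nat_const card_fixed.
  have -> : (q ^ m.+1 = \sum_(c in fixed) q ^ m)%N.
    by rewrite sum_nat_const card_fixed expnS.
  rewrite -big_split /=.
  by apply: eq_bigr => c cF; apply: card_ker_trM_ratio.
by move: part sumF; rewrite cardK; lia.
Qed.

(** * Reduction of GF(q)^* to a group of order g *)

Variables (F : finFieldType) (g n : nat) (b : K) (eta : F).
Hypotheses (g_dvd : (g %| q - 1)%N) (nE : (n * (q - 1) = #|K| - 1)%N).
Hypotheses (b_prim : (n * (q - 1)).-primitive_root b) (eta_prim : g.-primitive_root eta).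

(** A generator of GF(q)^*, since b has order n (q - 1); n steps along the powers of b multiply by
    it. *)
Let gamma := b ^+ n.

Lemma gamma_prim : (q - 1).-primitive_root gamma.
Proof.
have n0 : (0 < n)%N by have := prim_order_gt0 b_prim; rewrite muln_gt0 => /andP[].
by have := dvdn_prim_root b_prim (dvdn_mull n (dvdnn (q - 1))); rewrite mulnK ?subn_gt0.
Qed.

Lemma gamma_neq0 : gamma != 0.
Proof. exact: prim_root_neq0 gamma_prim. Qed.

Lemma fixedP x : x \in fixed -> x = 0 \/ exists j : nat, x = gamma ^+ j.
Proof.
rewrite inE => /eqP xq; have [->|x0] := eqVneq x 0; [by left | right].
have /(prim_rootP gamma_prim)[j ->] : x ^+ (q - 1) = 1; last by exists j.
by apply: (mulfI x0); rewrite -exprS subn1 prednK ?mulr1 // ltnW.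
Qed.

Lemma gammaX_fixed j : gamma ^+ j \in fixed.
Proof.
have : gamma \in fixed.
  rewrite inE -{1}(subnK (ltnW q_gt1)) addn1 exprS.
  by rewrite (prim_expr_order gamma_prim) mulr1.
by move=> gF; elim: j => [|j IH]; rewrite ?fixed1 // exprS fixedM.
Qed.

(* A homomorphism from GF(q)^* inside K onto <[eta]> in F, so that no embedding *)
(* of F in K has to be chosen; it is 0 at 0 and junk-valued 0 outside GF(q).    *)
Definition psi (x : K) : F :=
  if [pick j : 'I_(q - 1) | x == gamma ^+ j] is Some j then eta ^+ j else 0.

Lemma psi0 : psi 0 = 0.
Proof.
rewrite /psi; case: pickP => // j; rewrite eq_sym expf_eq0.
by rewrite (negPf gamma_neq0) andbF.
Qed.

(** The choice of exponent is immaterial: g divides q - 1, so exponents congruent modulo q - 1 are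
    congruent modulo g. *)
Lemma psiX j : psi (gamma ^+ j) = eta ^+ j.
Proof.
rewrite /psi; case: pickP => [i|noi].
  rewrite (eq_prim_root_expr gamma_prim) => ij; apply/eqP.
  rewrite eq_sym (eq_prim_root_expr eta_prim).
  by rewrite -(modn_dvdm j g_dvd) (eqP ij) modn_dvdm.
have q1 : (0 < q - 1)%N by rewrite subn_gt0.
have := noi (Ordinal (ltn_pmod j q1)).
by rewrite /= (prim_expr_mod gamma_prim) eqxx.
Qed.

Lemma psiM x y : x \in fixed -> y \in fixed -> psi (x * y) = psi x * psi y.
Proof.
case/fixedP => [->|[i ->]]; first by rewrite mul0r psi0 mul0r.
case/fixedP => [->|[j ->]]; first by rewrite mulr0 psi0 mulr0.
by rewrite -exprD !psiX exprD.
Qed.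

Lemma psi_eq0 x : x \in fixed -> (psi x == 0) = (x == 0).
Proof.
case/fixedP => [->|[j ->]]; first by rewrite psi0 !eqxx.
rewrite psiX (negPf (expf_neq0 j gamma_neq0)).
by rewrite (negPf (expf_neq0 j (prim_root_neq0 eta_prim))).
Qed.

Definition psi_ker : {set K} := [set c in fixed | psi c == 1].

Lemma card_psi_ker : (#|psi_ker| * g = q - 1)%N.
Proof.
have g0 := prim_order_gt0 eta_prim.
have q1 : (0 < q - 1)%N by rewrite subn_gt0.
suff -> : #|psi_ker| = ((q - 1) %/ g)%N by rewrite divnK.
pose e (j : 'I_((q - 1) %/ g)) := gamma ^+ (g * j).
have lt_e (j : 'I_((q - 1) %/ g)) : (g * j < q - 1)%N.
  by rewrite -{2}(divnK g_dvd) mulnC ltn_pmul2r.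
have e_inj : injective e.
  move=> i j /eqP; rewrite (eq_prim_root_expr gamma_prim) !modn_small ?lt_e //.
  by rewrite eqn_pmul2l // => /eqP/val_inj.
rewrite -[RHS]card_ord -(card_codom e_inj); apply: eq_card => x.
rewrite inE; apply/andP/codomP => [[/fixedP[->|[j ->]]]|[j ->]].
- by rewrite psi0 eq_sym oner_eq0.
- rewrite psiX -(prim_order_dvd eta_prim) => /dvdnP[k ->].
  have kP : (k %% ((q - 1) %/ g) < (q - 1) %/ g)%N.
    by rewrite ltn_pmod // divn_gt0 // dvdn_leq.
  exists (Ordinal kP); rewrite /e /= -(prim_expr_mod gamma_prim).
  by rewrite -{1}(divnK g_dvd) -muln_modl mulnC.
- by rewrite gammaX_fixed psiX exprM (prim_expr_order eta_prim) expr1n.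
Qed.

Definition agree a a' : {set K} := [set x | psi (tr (a * x)) == psi (tr (a' * x))].

(** Both traces vanish on q^m / q elements, and each of the (q - 1) / g ratios in [psi_ker]
    contributes q^m - q^m / q more. *)
Lemma card_agree a a' : a != 0 -> a' != 0 -> a / a' \notin fixed ->
  (q * g * #|agree a a'| =
   g * q ^ m + (q - 1) ^ 2 * q ^ m)%N.
Proof.
move=> a0 a'0 aF.
pose Z := #|both_zero a a'|.
pose R := psi_ker.
have -> : #|agree a a'| = (Z + \sum_(c in R) #|ratio_set a a' c|)%N.
  rewrite -(cardsID [set x | tr (a' * x) == 0]); congr (_ + _)%N.
    apply: eq_card => x; rewrite !inE; case: (tr (a' * x) =P 0) => [->|]; rewrite ?andbF //.
    by rewrite psi0 psi_eq0 ?tr_fixed.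
  rewrite -[LHS]sum1_card (partition_big (fun x => tr (a * x) / tr (a' * x)) (mem R)) /=.
    apply: eq_bigr => c; rewrite inE => /andP[cF /eqP c1].
    rewrite sum1dep_card; apply: eq_card => x.
    rewrite !inE; case: eqP => //= /eqP t0; rewrite divf_eq //.
    by case: (tr (a * x) =P _) => [->|]; rewrite ?andbF // psiM ?tr_fixed // c1 mul1r eqxx.
  move=> x /setDP[]; rewrite inE => /eqP e; rewrite inE => t0.
  rewrite [X in is_true X]inE.
  have rF : tr (a * x) / tr (a' * x) \in fixed by rewrite fixedM ?fixedV ?tr_fixed.
  rewrite rF /=; apply/eqP/(mulIf (_ : psi (tr (a' * x)) != 0)).
    by rewrite psi_eq0 ?tr_fixed.
  by rewrite -psiM ?tr_fixed // divfK // mul1r.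
have sumR : ((\sum_(c in R) #|ratio_set a a' c|) + #|R| * Z = #|R| * q ^ m)%N.
  rewrite -!sum_nat_const -big_split /=.
  apply: eq_bigr => c; rewrite inE => /andP[cF _]; exact: card_ker_trM_ratio.
have := card_ker_tr2 a0 a'0 aF; rewrite -/Z.
have := card_psi_ker; rewrite -/R.
move: sumR; move: (\sum_(c in R) _)%N => s; move: (#|R|) Z (q ^ m)%N => r Z P.
move: q_gt1; case: (q) => // k _; rewrite subn1 /= => eP ek eZ.
have -> : (s = r * k * Z)%N by apply: (@addIn (r * Z)); rewrite eP -eZ; lia.
by rewrite -eZ -ek; ring.
Qed.

(** * The codewords, their weights, distances and shifts *)

Definition word a : {ffun 'I_n -> F} := [ffun i : 'I_n => psi (tr (a * b ^+ i))].

Lemma tr_gammaM a x : tr (a * (gamma * x)) = gamma * tr (a * x).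
Proof. by rewrite mulrCA trZ // -(expr1 gamma) gammaX_fixed. Qed.

Lemma psi_gamma x : x \in fixed -> psi (gamma * x) = eta * psi x.
Proof. by move=> xF; rewrite -(expr1 gamma) psiM ?gammaX_fixed // psiX expr1. Qed.

(* The powers b ^+ i, i < n, represent the points of the projective space       *)
(* K^* / GF(q)^*.                                                               *)
Lemma card_homogeneous (P : pred K) : ~~ P 0 -> (forall x, P (gamma * x) = P x) ->
  #|[set x | P x]| = ((q - 1) * #|[set i : 'I_n | P (b ^+ i)]|)%N.
Proof.
move=> P0 Pg.
(* As b^(n + i) = gamma b^i, the predicate is n-periodic along the powers of b. *)
have sum_periodic t : (\sum_(i < t * n) P (b ^+ i) = t * #|[set i : 'I_n | P (b ^+ i)]|)%N.
  elim: t => [|t IH]; first by rewrite big_ord0.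
  rewrite mulSn big_split_ord mulSn -{}IH /= -sum1dep_card [X in _ = (X + _)%N]big_mkcond /=.
  congr (_ + _)%N; apply: eq_bigr => i _ /=.
  by rewrite exprD Pg.
rewrite -sum_periodic mulnC -big_mkcond /= sum1dep_card.
pose e (i : 'I_(n * (q - 1))) := b ^+ i.
have e_inj : injective e.
  move=> i j /eqP; rewrite (eq_prim_root_expr b_prim) !modn_small //.
  by move=> /eqP/val_inj.
rewrite -[RHS](card_imset _ e_inj); apply: eq_card => x; rewrite inE.
apply/idP/imsetP => [Px|[i]]; last by rewrite inE => ? ->.
have x0 : x != 0 by apply: contraNneq P0 => <-.
have /(prim_rootP b_prim)[i xi] : x ^+ (n * (q - 1)) = 1.
  by apply: (mulfI x0); rewrite -exprS nE subn1 prednK ?expf_card ?mulr1 // cardK expn_gt0 ltnW.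
by exists i => //; rewrite inE -xi.
Qed.

(** The complement of [agree a a'] omits 0 and is stable under multiplication by gamma, so
    [card_homogeneous] applies to it. *)
Lemma hdist_word a a' : ((q - 1) * hdist (word a) (word a') + #|agree a a'| = q ^ m.+1)%N.
Proof.
have := @card_homogeneous (fun x => psi (tr (a * x)) != psi (tr (a' * x))).
rewrite !mulr0 eqxx => /(_ isT) H.
rewrite -cardK -(cardsC (agree a a')) [in RHS]addnC; congr (_ + _)%N.
rewrite (_ : hdist _ _ = #|[set i : 'I_n |
  psi (tr (a * b ^+ i)) != psi (tr (a' * b ^+ i))]|); last first.
  by apply: eq_card => i; rewrite !inE !ffunE.
rewrite -H; first by apply: eq_card => x; rewrite !inE.
move=> x; rewrite !tr_gammaM !psi_gamma ?tr_fixed // (inj_eq (mulfI _)) //.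
exact: prim_root_neq0 eta_prim.
Qed.

Lemma weight_word a : a != 0 -> weight 0 (word a) = (q ^ m)%N.
Proof.
move=> a0; have := @card_homogeneous (fun x => psi (tr (a * x)) != 0).
rewrite mulr0 tr0 psi0 eqxx => /(_ isT) H.
have q1 : (0 < q - 1)%N by rewrite subn_gt0.
apply/eqP; rewrite -(eqn_pmul2l q1) [eqbRHS]mulnBl mul1n -expnS -cardK -(card_ker_trM a0).
rewrite -cardsT -(cardsID [set x | tr (a * x) == 0] setT) setTI addKn; apply/eqP.
rewrite (_ : weight _ _ = #|[set i : 'I_n | psi (tr (a * b ^+ i)) != 0]|); last first.
  by apply: eq_card => i; rewrite !inE !ffunE.
rewrite -H; first by apply: eq_card => x; rewrite !inE psi_eq0 ?tr_fixed ?andbT.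
move=> x; rewrite tr_gammaM psi_gamma ?tr_fixed // mulf_eq0.
by rewrite (negPf (prim_root_neq0 eta_prim)).
Qed.

Lemma wordZ c a : c \in fixed -> word (c * a) = [ffun i => psi c * word a i].
Proof.
by move=> cF; apply/ffunP => i; rewrite !ffunE -mulrA trZ // psiM ?tr_fixed.
Qed.

(** Scaling by [psi c] other than 1 changes exactly the nonzero entries. *)
Lemma hdist_wordZ c a : a != 0 -> c \in fixed -> psi c != 1 ->
  hdist (word (c * a)) (word a) = (q ^ m)%N.
Proof.
move=> a0 cF c1; rewrite -(weight_word a0) wordZ //; apply: eq_card => i.
by rewrite !inE ffunE -subr_eq0 -[X in _ - X]mul1r -mulrBl mulf_eq0 subr_eq0 (negPf c1).
Qed.

(** Moving every entry one place on divides the parameter by b; the wrapped entry a b^(n-1) is gamma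
    (a / b), and the factor eta^-1 cancels the image of gamma under [psi]. *)
Lemma eta_shift_word a : eta_shift eta^-1 (word a) = word (a / b).
Proof.
have b0 := prim_root_neq0 b_prim.
apply/ffunP => i; rewrite !ffunE -mulrA.
case: ifP => [/eqP i0|i0] /=; last first.
  case: i i0 => -[|i] //= lt_in _; rewrite exprS mulKf //.
  by rewrite modnDr modn_small // ltnW.
have n0 : (0 < n)%N := leq_ltn_trans (leq0n _) (ltn_ord i).
have e0 := prim_root_neq0 eta_prim.
rewrite i0 add0n modn_small ?prednK // expr0 mulr1.
apply: (mulfI e0); rewrite mulVKf // -psi_gamma ?tr_fixed // -tr_gammaM.
by rewrite /gamma -{2}(prednK n0) exprSr mulfK.
Qed.

(** * The code: distances, size and the single orbit *)

Variable d : nat.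
(* The defining equation of d, cleared of denominators. *)
Hypothesis dE : (q * g * d + (g + 1) * (q - 1) * q ^ m = 2 * g * q * q ^ m)%N.

Lemma hdist_word_indep a a' : a != 0 -> a' != 0 -> a / a' \notin fixed ->
  hdist (word a) (word a') = d.
Proof.
move=> a0 a'0 aF; have := hdist_word a a'; have := card_agree a0 a'0 aF.
have g0 := prim_order_gt0 eta_prim.
move: dE q_gt1; rewrite (expnS q m); case: (q) => // k; rewrite subn1 /= ltnS.
move: (hdist _ _) #|_| => h A; move: (k.+1 ^ m)%N => P eD k0 eA eH.
(* Both sides equal (q - 1) q^m (g (q + 1) - (q - 1)). *)
have : (k * (k.+1 * g * h) = k * (k.+1 * g * d))%N.
  by have := congr1 (muln (k.+1 * g)) eH; have := congr1 (muln k) eD; lia.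
by move/eqP; rewrite !eqn_pmul2l // ?muln_gt0 ?g0 // => /eqP.
Qed.

Lemma d_gt0 : (0 < d)%N.
Proof.
have g0 := prim_order_gt0 eta_prim.
have P0 : (0 < q ^ m)%N by rewrite expn_gt0 ltnW.
move: dE q_gt1; rewrite lt0n; case: (eqVneq d 0%N) => // ->; rewrite muln0 add0n.
by move: g0 P0; move: (q ^ m)%N => P; nia.
Qed.

(** With denominators cleared, this amounts to g <= q - 1. *)
Lemma d_le_weight : (d <= q ^ m)%N.
Proof.
have g0 := prim_order_gt0 eta_prim.
have gq : (g <= q - 1)%N by rewrite dvdn_leq ?subn_gt0.
have q0 := ltnW q_gt1.
have qg0 : (0 < q * g)%N by rewrite muln_gt0 q0.
rewrite -(leq_pmul2l qg0).
move: dE q_gt1 gq; move: (q ^ m)%N (q * g * d)%N => P D; nia.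
Qed.

(** A ratio outside GF(q) would give distance d > 0, and one outside the kernel of [psi] distance
    q^m > 0; that kernel consists of the powers of gamma^g. *)
Lemma word_inj a a' : a != 0 -> a' != 0 -> word a = word a' ->
  exists k : nat, a = gamma ^+ (g * k) * a'.
Proof.
move=> a0 a'0 eqw.
have hd0 : hdist (word a) (word a') = 0%N.
  by rewrite eqw; apply/eqP; rewrite cards_eq0; apply/eqP/setP => i; rewrite !inE eqxx.
have [aF|aF] := boolP (a / a' \in fixed); last first.
  by have := d_gt0; rewrite -(hdist_word_indep a0 a'0 aF) hd0.
have [c1|c1] := eqVneq (psi (a / a')) 1; last first.
  have := hdist_wordZ a'0 aF c1; rewrite divfK // hd0 => /esym/eqP.
  by rewrite expn_eq0 gtn_eqF // ltnW.
case/fixedP: aF c1 => [->|[j ej]]; first by rewrite psi0 => /eqP; rewrite eq_sym oner_eq0.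
rewrite ej psiX => /eqP; rewrite -(prim_order_dvd eta_prim) => /dvdnP[k jk].
by exists k; rewrite mulnC -jk -ej divfK.
Qed.

Lemma word_dist a a' : a != 0 -> a' != 0 -> word a != word a' ->
  (d <= hdist (word a) (word a'))%N.
Proof.
move=> a0 a'0 neqw.
have [aF|aF] := boolP (a / a' \in fixed); last by rewrite hdist_word_indep.
have [c1|c1] := eqVneq (psi (a / a')) 1; last first.
  by have := hdist_wordZ a'0 aF c1; rewrite divfK // => ->; apply: d_le_weight.
case/eqP: neqw; rewrite -{1}(divfK a'0 a) wordZ // c1; apply/ffunP => i.
by rewrite ffunE mul1r.
Qed.

Definition code : {set {ffun 'I_n -> F}} := [set word a | a in [set~ 0]].

(** Since gamma^(g k) = b^(n g k), equal words at b^i and b^j force i and j to be congruent modulo g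
    n. *)
Lemma card_code_ge : (g * n <= #|code|)%N.
Proof.
have b0 := prim_root_neq0 b_prim.
pose e (i : 'I_(g * n)) := word (b ^+ i).
have e_inj : injective e.
  move=> i j /word_inj; rewrite !expf_neq0 // => /(_ isT isT)[k].
  rewrite /gamma -exprM -exprD => /eqP; rewrite (eq_prim_root_expr b_prim) => /eqP ij.
  have gn_dvd : (g * n %| n * (q - 1))%N by rewrite mulnC dvdn_mul.
  apply: val_inj; rewrite /= -(modn_small (ltn_ord i)) -(modn_dvdm i gn_dvd) ij.
  by rewrite modn_dvdm // mulnA (mulnC n) mulnC modnMDl modn_small.
rewrite -[X in (X <= _)%N]card_ord -(card_codom e_inj).
apply/subset_leq_card/subsetP => _ /codomP[i ->].
by apply: imset_f; rewrite !inE expf_neq0.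
Qed.

Lemma code_cw_code (A : {set F}) : 0 \in A -> (forall j : nat, eta ^+ j \in A) ->
  cw_code 0 A d (q ^ m) code.
Proof.
move=> A0 AX; apply/and3P; split.
- apply/and3P; split=> //.
    by apply/set0Pn; exists (word 1); apply: imset_f; rewrite !inE oner_eq0.
  apply/forall_inP => _ /imsetP[a _ ->]; apply/forallP => i; rewrite ffunE.
  by case: (fixedP (tr_fixed (a * b ^+ i))) => [->|[j ->]]; rewrite ?psi0 // psiX.
- apply/forall_inP => _ /imsetP[a a0 ->]; rewrite !inE in a0.
  by rewrite weight_word.
- apply/forall_inP => _ /imsetP[a a0 ->]; apply/forall_inP => _ /imsetP[a' a'0 ->].
  rewrite !inE in a0 a'0.
  by apply/implyP => neqw; exact: word_dist.
Qed.

Lemma code_min_dist : (1 < n)%N -> min_dist_eq d code.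
Proof.
move=> n1; have b0 := prim_root_neq0 b_prim.
have : cw_code 0 setT d (q ^ m) code by apply: code_cw_code => [|j]; rewrite inE.
case/and3P=> _ _ dist; rewrite /min_dist_eq dist /=.
(* The words of 1 and b realise d: if b lay in GF(q), its order n (q - 1) would divide q - 1,
   against n > 1. *)
have bF : 1 / b \notin fixed.
  rewrite div1r; apply/negP => /fixedV; rewrite invrK => /fixedP[/eqP|[j bj]].
    by rewrite (negPf b0).
  have : b ^+ (q - 1) == 1.
    by rewrite bj -exprM mulnC exprM (prim_expr_order gamma_prim) expr1n.
  rewrite -(prim_order_dvd b_prim) => /dvdn_leq; rewrite subn_gt0 => /(_ q_gt1).
  by rewrite -{2}[(q - 1)%N]mul1n leq_pmul2r ?subn_gt0 // leqNgt n1.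
have hd := hdist_word_indep (oner_neq0 _) b0 bF.
apply/existsP; exists (word 1); rewrite imset_f ?inE ?oner_eq0 //=.
apply/existsP; exists (word b); rewrite imset_f ?inE //= hd eqxx andbT.
apply: contraTneq d_gt0 => e; rewrite -hd e -leqNgt leqn0 cards_eq0.
by apply/eqP/setP => i; rewrite !inE eqxx.
Qed.

Lemma code_orbit x :
  x \in code <-> exists k : nat, x = iter k (eta_shift eta^-1) (word 1).
Proof.
have b0 := prim_root_neq0 b_prim.
have iterE k : iter k (eta_shift eta^-1) (word 1) = word (b^-1 ^+ k).
  by elim: k => [|k IH]; rewrite ?expr0 // iterS IH eta_shift_word exprSr.
split=> [/imsetP[a]|[k ->]]; last first.
  by rewrite iterE imset_f // !inE expf_neq0 // invr_eq0.
rewrite !inE => a0 ->.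
have /(prim_rootP b_prim)[k ak] : a^-1 ^+ (n * (q - 1)) = 1.
  have a'0 : a^-1 != 0 by rewrite invr_eq0.
  by apply: (mulfI a'0); rewrite -exprS nE subn1 prednK ?expf_card ?mulr1 // cardK expn_gt0 ltnW.
by exists k; rewrite iterE exprVn -ak invrK.
Qed.

End Trace.

(** * Primitive elements and the final assembly *)

Lemma finField_prim_root (K : finFieldType) : exists b : K, (#|K| - 1).-primitive_root b.
Proof.
have K1 := finRing_gt1 K.
have /hasP[b _ b_prim] : has (#|K| - 1).-primitive_root (enum [set~ (0 : K)]).
  apply: has_prim_root.
  - by rewrite subn_gt0.
  - apply/allP => x; rewrite mem_enum !inE => x0; rewrite unity_rootE; apply/eqP.
    by apply: (mulfI x0); rewrite -exprS subn1 prednK ?expf_card ?mulr1 // ltnW.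
  - exact: enum_uniq.
  - by rewrite -cardE cardsC1 subn1.
by exists b.
Qed.

Lemma unit_prim_root (F : finFieldType) (u : {unit F}) : #[u]%g.-primitive_root (val u).
Proof.
apply/andP; split; first exact: order_gt0.
apply/forallP => i; rewrite unity_rootE -FinRing.val_unitX -[1]FinRing.val_unit1 val_eqE.
rewrite -order_dvdn; apply/eqP; apply/idP/eqP => [/dvdn_leq h|->]; last exact: dvdnn.
by apply/eqP; rewrite eqn_leq ltn_ord h.
Qed.

Local Close Scope ring_scope.

(** K is any field of order q^(m+1), not an extension built over F; [psi] is the only link between
    the two fields. *)
Lemma exists_constacyclic_code (q g m n d p e : nat) (F : finFieldType) (A : {set F}) (eta : F) :
  prime p -> 0 < e -> q = p ^ e -> g %| q - 1 ->
  n * (q - 1) = q ^ m.+1 - 1 -> 1 < n ->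
  q * g * d + (g + 1) * (q - 1) * q ^ m = 2 * g * q * q ^ m ->
  (g.-primitive_root eta)%R -> 0%R \in A -> (forall j : nat, eta ^+ j \in A)%R ->
  exists S : {set {ffun 'I_n -> F}},
    [/\ cw_code 0%R A d (q ^ m) S, min_dist_eq d S, g * n <= #|S|
      & exists c : {ffun 'I_n -> F}, forall x : {ffun 'I_n -> F},
          x \in S <-> exists k : nat, x = iter k (eta_shift eta^-1%R) c].
Proof.
move=> p_pr e0 qE g_dvd nE n1 dE eta_prim A0 AX.
have me0 : 0 < e * m.+1 by rewrite muln_gt0 e0.
have q_gt1 : 1 < q by rewrite qE -(exp1n e) ltn_exp2r ?prime_gt1.
have [K pK cK] := pPrimePowerField p_pr me0.
have cardK : #|K| = q ^ m.+1 by rewrite cK qE expnM.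
have q_char : [pchar K]%R.-nat q.
  by rewrite qE pnatX (pnatE _ p_pr) pK.
have [b b_prim] := finField_prim_root K.
have nE' : n * (q - 1) = #|K| - 1 by rewrite cardK.
rewrite -nE' in b_prim.
exists (code q m n b eta); split.
- exact (code_cw_code q_gt1 q_char cardK g_dvd nE' b_prim eta_prim dE A0 AX).
- exact (code_min_dist q_gt1 q_char cardK g_dvd nE' b_prim eta_prim dE n1).
- exact (card_code_ge q_gt1 q_char cardK g_dvd nE' b_prim eta_prim dE).
- exists (word q m n b eta 1%R).
  exact (code_orbit q_gt1 q_char cardK g_dvd nE' b_prim eta_prim).
Qed.

Theorem theorem6 (q g m : nat)
    (q_prime_power : exists p k : nat, [/\ prime p, 0 < k & q = p ^ k])
    (q_odd : odd q) (g_gt0 : 0 < g) (g_dvd : g %| q - 1) (m_gt1 : 1 < m) :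
  let n := (q ^ (m + 1) - 1) %/ (q - 1) in
  let d := 2 * q ^ m - ((g + 1) * (q ^ m - q ^ (m - 1))) %/ g in
  [/\ A_max (g + 1) (n - 1) d (q ^ m - 1) = q ^ m,
      A_max (g + 1) n d (q ^ m) = g * n
    & forall (F : finFieldType), #|F| = q ->
      forall omega : {unit F}, generator [set: {unit F}] omega ->
      let omega' : {unit F} := (omega ^+ ((q - 1) %/ g))%g in
      let alphabet : {set F} := 0%R |: [set val u | u in <[omega']>%g] in
      exists S : {set {ffun 'I_n -> F}},
        [/\ optimal_cw_code 0%R alphabet d (q ^ m) S,
            min_dist_eq d S,
            #|S| = g * n
          & exists c : {ffun 'I_n -> F}, forall x : {ffun 'I_n -> F},
              x \in S <-> exists k : nat, x = iter k (eta_shift (val omega')) c]].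
Proof.
move=> n d; case: q_prime_power => p [e [p_pr e0 qE]].
have q_gt1 : 1 < q by rewrite qE -(exp1n e) ltn_exp2r ?prime_gt1.
have q0 := ltnW q_gt1; have q1 : 0 < q - 1 by rewrite subn_gt0.
have geom j : (\sum_(i < j) q ^ i) * (q - 1) = q ^ j - 1.
  by rewrite !subn1 predn_exp mulnC.
have nE : n = \sum_(i < m.+1) q ^ i by rewrite /n addn1 -geom mulnK.
have nq : n * (q - 1) = q ^ m.+1 - 1 by rewrite nE geom.
have n1E : n - 1 = q * \sum_(i < m) q ^ i.
  rewrite nE big_ord_recl expn0 addKn big_distrr /=.
  by apply: eq_bigr => i _; rewrite -expnS.
have n1q : (n - 1) * (q - 1) = q * (q ^ m - 1) by rewrite n1E -mulnA geom.
have n_gt1 : 1 < n.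
  by rewrite -subn_gt0 n1E muln_gt0 q0 -(prednK (ltnW m_gt1)) big_ord_recl.
have P0 : 0 < q ^ m by rewrite expn_gt0 q0.
have dE : q * g * d + (g + 1) * (q - 1) * q ^ m = 2 * g * q * q ^ m.
  have [t qt] := dvdnP g_dvd.
  have qmE : q ^ m = q * q ^ (m - 1) by rewrite -expnS subn1 prednK // ltnW.
  have t0 : 0 < t by move: q1; rewrite qt muln_gt0 => /andP[].
  rewrite /d qmE; move: (q ^ (m - 1)) => P.
  (* The quotient by g in d is exact because g divides q - 1. *)
  have -> : q * P - P = (t * P) * g by rewrite -{2}[P]mul1n -mulnBl qt mulnAC.
  rewrite [X in X %/ _]mulnA mulnK // qt.
  have qs : q = (t * g).+1 by rewrite -qt subn1 prednK.
  (* The natural subtraction in d does not truncate, since (g + 1) t = q - 1 + t <= 2 q. *)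
  have le : (g + 1) * (t * P) <= 2 * (q * P).
    rewrite !mulnA leq_mul2r qs; apply/orP; right.
    by have := leq_pmulr t g_gt0; lia.
  rewrite mulnBr; apply/eqP; rewrite -(eqn_add2r (q * g * ((g + 1) * (t * P)))).
  rewrite addnAC subnK ?leq_mul2l ?le ?orbT //; apply/eqP; ring.
have codeP (F : finFieldType) (cF : #|F| = q) (omega : {unit F}) :
    generator [set: {unit F}] omega ->
    let omega' : {unit F} := (omega ^+ ((q - 1) %/ g))%g in
    let alphabet : {set F} := 0%R |: [set val u | u in <[omega']>%g] in
    #|alphabet| = g + 1 /\ exists S : {set {ffun 'I_n -> F}},
      [/\ cw_code 0%R alphabet d (q ^ m) S, min_dist_eq d S, g * n <= #|S|
        & exists c : {ffun 'I_n -> F}, forall x : {ffun 'I_n -> F},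
            x \in S <-> exists k : nat, x = iter k (eta_shift (val omega')) c].
  move=> gen omega' alphabet.
  have ord : #[omega]%g = q - 1.
    by rewrite orderE -(eqP gen) card_finField_unit cF subn1.
  have ord' : #[omega']%g = g.
    rewrite orderXdiv ord ?dvdn_div // -{1}(divnK g_dvd) mulKn //.
    by rewrite divn_gt0 // dvdn_leq.
  split.
    rewrite cardsU1 card_imset ?[X in _ + X]ord'; last exact: val_inj.
    rewrite addnC; congr (_ + _); apply/eqP; rewrite eqb1; apply/imsetP => -[u _ u0].
    by have := valP u; rewrite -u0 unitr0.
  (* The code built from eta is an orbit of the eta^-1 shift, so eta has to be the inverse of
     omega'. *)
  have eta_prim : (g.-primitive_root (val omega'^-1%g))%R.
    by rewrite -ord' -orderV unit_prim_root.
  have -> : val omega' = ((val omega'^-1%g)^-1)%R by rewrite FinRing.val_unitV invrK.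
  apply: (exists_constacyclic_code p_pr e0 qE g_dvd nq n_gt1 dE eta_prim).
    by rewrite setU11.
  move=> j; rewrite -FinRing.val_unitX inE imset_f ?orbT //.
  by rewrite groupX // groupV cycle_id.
have max_short : A_max (g + 1) (n - 1) d (q ^ m - 1) <= q ^ m.
  exact: A_max_shortened_le q_gt1 g_gt0 n1q dE.
have johnson : A_max (g + 1) n d (q ^ m) * q ^ m <=
    n * g * A_max (g + 1) (n - 1) d (q ^ m - 1).
  have := A_max_le_of_shortened g (n - 1) d (q ^ m).
  by rewrite -subn1 -[(n - 1).+1]addn1 subnK // ltnW.
have max_le : A_max (g + 1) n d (q ^ m) <= g * n.
  rewrite -(leq_pmul2r P0) (leq_trans johnson) // (mulnC g) leq_mul2l max_short.
  by rewrite orbT.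
have max_ge : g * n <= A_max (g + 1) n d (q ^ m).
  have [F pF cF] := pPrimePowerField p_pr e0.
  have /cyclicP[omega gen] := field_unit_group_cyclic [set: {unit F}].
  have genU : generator [set: {unit F}] omega by rewrite /generator gen.
  have [<- [S [cwS _ leS _]]] := codeP F (etrans cF (esym qE)) omega genU.
  exact: leq_trans leS (leq_A_max cwS).
have maxE : A_max (g + 1) n d (q ^ m) = g * n by apply/eqP; rewrite eqn_leq max_le.
split=> //.
  apply/eqP; rewrite eqn_leq max_short /=.
  have gn0 : 0 < n * g by rewrite muln_gt0 g_gt0 andbT ltnW.
  by rewrite -(leq_pmul2l gn0) (leq_trans _ johnson) // maxE (mulnC g).
move=> F cF omega gen omega' alphabet.
have [cA [S [cwS dS leS orb]]] := codeP F cF omega gen.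
have cardS : #|S| = g * n.
  by apply/eqP; rewrite eqn_leq leS -maxE -cA (leq_A_max cwS).
by exists S; split=> //; rewrite /optimal_cw_code cwS cA maxE cardS eqxx.
Qed.
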